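(* Let a Boolean control network $x(t+1)=Lu(t)x(t)$, $y(t)=Hx(t)$ be given, with weighted pair graph $\mathcal{G}=(\mathcal{V},\mathcal{E},\mathcal{W})$. The network is not Type-2 observable if and only if there is a non-diagonal vertex $(\delta_N^i,\delta_N^j)$ of $\mathcal{G}$ such that the deterministic finite automaton $A_{(\delta_N^i,\delta_N^j)}$ recognizes the language $(\Delta_M)^*$ of all finite words over $\Delta_M$.
   Context: Fix positive integers $n,m,q$ and put $N=2^n$, $M=2^m$, $Q=2^q$. For a positive integer $k$, $\delta_k^i$ is the $i$-th column of the identity matrix $I_k$ and $\Delta_k=\{\delta_k^1,\dots,\delta_k^k\}$. A logical matrix of size $k\times s$ is one all of whose columns lie in $\Delta_k$. A Boolean control network (BCN, in algebraic form) is a system $x(t+1)=Lu(t)x(t)$, $y(t)=Hx(t)$, $t=0,1,2,\dots$, with states $x(t)\in\Delta_N$, inputs $u(t)\in\Delta_M$, outputs $y(t)\in\Delta_Q$, where $L$ is an $N\times NM$ logical matrix and $H$ is a $Q\times N$ logical matrix. Products are semi-tensor products; concretely $Lux=L(u\otimes x)$ for $u\in\Delta_M$, $x\in\Delta_N$, with $\otimes$ the Kronecker product. For $x_0\in\Delta_N$, $p\ge 1$ and $U=u_0\cdots u_{p-1}\in(\Delta_M)^p$, put $x_{t+1}=Lu_tx_t$ for $0\le t<p$ and $(HL)_{x_0}^p(U)=(Hx_1)\cdots(Hx_p)\in(\Delta_Q)^p$. Type-2 observability: for any distinct $x_0,\bar x_0\in\Delta_N$ there exist $p\ge1$ and $U\in(\Delta_M)^p$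 such that $Hx_0=H\bar x_0$ implies $(HL)_{x_0}^p(U)\neq(HL)_{\bar x_0}^p(U)$. Weighted pair graph $\mathcal{G}=(\mathcal{V},\mathcal{E},\mathcal{W})$: $\mathcal{V}$ is the set of unordered pairs $(x,x')$ (so $(x,x')=(x',x)$, and $x=x'$ is allowed) of elements of $\Delta_N$ with $Hx=Hx'$. For vertices $v=(x_1,x_1')$, $w=(x_2,x_2')$, let $\mathcal{W}((v,w))$ be the set of $u\in\Delta_M$ such that ($Lux_1=x_2$ and $Lux_1'=x_2'$) or ($Lux_1=x_2'$ and $Lux_1'=x_2$). The directed edge $(v,w)$ belongs to $\mathcal{E}$ iff this set is nonempty, and then it is the weight of the edge. A vertex $(x,x)$ is called diagonal; the other vertices are non-diagonal. A deterministic finite automaton (DFA) is $A=(S,\Sigma,\sigma,s_0,F)$ with finite state set $S$, finite nonempty alphabet $\Sigma$, initial state $s_0\in S$, final states $F\subset S$, and a partial transition function $\sigma:S\times\Sigma\to S$, extended naturally to a partial function $S\times\Sigma^*\to S$, where $\Sigma^*$ is the set of all finite words including the empty word. The language recognized by $A$ is $L(A)=\{w\in\Sigma^*\mid \sigma(s_0,w)\text{ is defined and lies in }F\}$. The DFA $A_{(\delta_N^i,\delta_N^j)}$, for a non-diagonal vertex $(\delta_N^i,\delta_N^j)$: its alphabet is $\Delta_M$; its initial state is the vertex $(\delta_N^i,\delta_N^j)$; its states are this vertex together with all vertices $v\in\mathcal{V}$ reachable from it by a directed path in $\mathcal{G}$; its transition graph is the subgraph of $\mathcal{G}$ induced on these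 vertices, i.e. the transition function at $(v,u)$ has value $w$ iff $(v,w)\in\mathcal{E}$ and $u\in\mathcal{W}((v,w))$, and is undefined at $(v,u)$ if no such $w$ exists. All states are final. *)

(* Defs.v *)
From HB Require Import structures.
From mathcomp Require Import all_boot all_algebra.
From mathcomp Require Import mxtens.

Set Implicit Arguments.
Unset Strict Implicit.
Unset Printing Implicit Defensive.

Import GRing.Theory.
Local Open Scope ring_scope.

(** ** Logical vectors and logical matrices

    All entries are 0 or 1; they are taken in [int]. Indices start at 0, so
    the vector written delta_k^i in 1-based notation is [delta_vec] at i - 1. *)

Definition delta_vec (k : nat) (i : 'I_k) : 'cV[int]_k := col i 1%:M.

Definition delta_seq (k : nat) : seq 'cV[int]_k := codom (@delta_vec k).

(** Delta_k as a finite type of column vectors. *)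
Notation Delta k := (seq_sub (delta_seq k)).

Definition logical_mx (k s : nat) (A : 'M[int]_(k, s)) : Prop :=
  forall j : 'I_s, col j A \in delta_seq k.

Lemma logical_mulmx (k s : nat) (A : 'M[int]_(k, s)) (x : 'cV[int]_s) :
  logical_mx A -> x \in delta_seq s -> A *m x \in delta_seq k.
Proof.
by move=> hA /codomP[j ->]; rewrite /delta_vec colE mul1mx -colE; apply: hA.
Qed.

Lemma tensmx_delta (k s : nat) (x : 'cV[int]_k) (y : 'cV[int]_s) :
  x \in delta_seq k -> y \in delta_seq s ->
  (x *t y : 'cV_(k * s)) \in delta_seq (k * s).
Proof.
move=> /codomP[i ->] /codomP[j ->]; apply/codomP; exists (mxtens_index (i, j)).
apply/matrixP=> a b; case: (mxtens_indexP a) => a1 a2.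
rewrite !mxE mxtens_indexK /= -natrM mulnb; congr ((nat_of_bool _)%:R).
by rewrite (can_eq (@mxtens_indexK _ _)) xpair_eqE.
Qed.

(** ** Boolean control networks in algebraic form *)

Record bcn (n m q : nat) := Bcn {
  bcn_L : 'M[int]_(2 ^ n, 2 ^ m * 2 ^ n);
  bcn_H : 'M[int]_(2 ^ q, 2 ^ n);
  bcn_L_logical : logical_mx bcn_L;
  bcn_H_logical : logical_mx bcn_H
}.

Section Network.

Variables (n m q : nat) (B : bcn n m q).

Local Notation state := (Delta (2 ^ n)).
Local Notation input := (Delta (2 ^ m)).
Local Notation output := (Delta (2 ^ q)).

Lemma bcn_step_subproof (u : input) (x : state) :
  bcn_L B *m (ssval u *t ssval x) \in delta_seq (2 ^ n).
Proof.
apply: logical_mulmx (@bcn_L_logical _ _ _ B) _.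
by apply: tensmx_delta; apply: ssvalP.
Qed.

(** The semi-tensor product L u x is L times the Kronecker product of u
    and x; [tensmx] orders its indices lexicographically, the first factor
    being the major one. *)
Definition bcn_step (u : input) (x : state) : state :=
  SeqSub (bcn_step_subproof u x).

Lemma bcn_out_subproof (x : state) : bcn_H B *m ssval x \in delta_seq (2 ^ q).
Proof. by apply: logical_mulmx (@bcn_H_logical _ _ _ B) _; apply: ssvalP. Qed.

Definition bcn_out (x : state) : output := SeqSub (bcn_out_subproof x).

(** The states x_1, ..., x_p driven from x_0 by u_0 ... u_(p-1). *)
Definition bcn_traj (p : nat) (x0 : state) (U : p.-tuple input) :
  p.-tuple state := [tuple of scanl (fun x u => bcn_step u x) x0 U].

Definition bcn_HL (p : nat) (x0 : state) (U : p.-tuple input) :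
  p.-tuple output := [tuple of map bcn_out (bcn_traj x0 U)].

Definition type2_observable : Prop :=
  forall x0 x0' : state, x0 <> x0' ->
  exists (p : nat) (U : p.-tuple input),
    (1 <= p)%N /\
    (bcn_out x0 = bcn_out x0' -> bcn_HL x0 U <> bcn_HL x0' U).

(** ** The weighted pair graph *)

(** The unordered pair (x, x') is the set {x, x'}, a singleton if x = x'. *)
Definition is_vertex (v : {set state}) : bool :=
  [exists x, exists x', (v == [set x; x']) && (bcn_out x == bcn_out x')].

Definition vertex : finType := {v : {set state} | is_vertex v}.

Definition weight (v w : vertex) : {set input} :=
  [set u | [exists x1, exists x1', exists x2, exists x2',
    [&& val v == [set x1; x1'], val w == [set x2; x2']
      & ((bcn_step u x1 == x2) && (bcn_step u x1' == x2'))
        || ((bcn_step u x1 == x2') && (bcn_step u x1' == x2))]]].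

Definition edge (v w : vertex) : bool := weight v w != set0.

Definition diagonal (v : vertex) : bool := [exists x, val v == [set x; x]].

End Network.

(** ** Deterministic finite automata *)

Record dfa (Sigma : finType) := Dfa {
  dfa_alphabet_gt0 : (0 < #|Sigma|)%N;
  dfa_state : finType;
  dfa_trans : dfa_state -> Sigma -> option dfa_state;
  dfa_init : dfa_state;
  dfa_final : {set dfa_state}
}.

Fixpoint dfa_run (Sigma : finType) (A : dfa Sigma) (s : dfa_state A)
    (w : seq Sigma) : option (dfa_state A) :=
  if w is a :: w' then obind (fun t => dfa_run t w') (dfa_trans s a)
  else Some s.

Definition dfa_language (Sigma : finType) (A : dfa Sigma) : pred (seq Sigma) :=
  fun w => if dfa_run (dfa_init A) w is Some s then s \in dfa_final A
           else false.

(** ** The automaton attached to a vertex of the weighted pair graph *)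

Lemma Delta_pow2_gt0 (k : nat) : (0 < #|{: Delta (2 ^ k)}|)%N.
Proof.
have h : (0 < 2 ^ k)%N by rewrite expn_gt0.
by apply/card_gt0P; exists (SeqSub (codom_f (@delta_vec _) (Ordinal h))).
Qed.

Section PairAutomaton.

Variables (n m q : nat) (B : bcn n m q) (v0 : vertex B).

Definition reach_vertex : finType :=
  {v : vertex B | connect (@edge _ _ _ B) v0 v}.

(** By [pair_transP] below at most one t qualifies, so that [pick] involves
    no choice. *)
Definition pair_trans (s : reach_vertex) (u : Delta (2 ^ m)) :
    option reach_vertex :=
  [pick t : reach_vertex |
    edge (val s) (val t) && (u \in weight (val s) (val t))].

Definition pair_dfa : dfa (Delta (2 ^ m)) :=
  {| dfa_alphabet_gt0 := Delta_pow2_gt0 m;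
     dfa_state := reach_vertex;
     dfa_trans := pair_trans;
     dfa_init := exist _ v0 (connect0 _ v0);
     dfa_final := [set: reach_vertex] |}.

End PairAutomaton.

Lemma weight_imset (n m q : nat) (B : bcn n m q) (v w : vertex B)
    (u : Delta (2 ^ m)) :
  (u \in weight v w) = (val w == bcn_step B u @: val v).
Proof.
rewrite inE; apply/idP/eqP.
  case/existsP=> x1 /existsP[x1' /existsP[x2 /existsP[x2']]].
  case/and3P=> /eqP-> /eqP-> /orP[]/andP[/eqP<- /eqP<-].
    by rewrite imsetU1 imset_set1.
  by rewrite imsetU1 imset_set1 setUC.
case: v => v /=; rewrite /is_vertex => /existsP[x /existsP[x']].
move=> /andP[/eqP-> _]; rewrite imsetU1 imset_set1 => wE.
apply/existsP; exists x; apply/existsP; exists x'.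
apply/existsP; exists (bcn_step B u x).
by apply/existsP; exists (bcn_step B u x'); rewrite wE !eqxx.
Qed.

Lemma pair_transP (n m q : nat) (B : bcn n m q) (v0 : vertex B)
    (s t : reach_vertex v0) (u : Delta (2 ^ m)) :
  pair_trans s u = Some t <->
  edge (val s) (val t) /\ u \in weight (val s) (val t).
Proof.
rewrite /pair_trans; split.
  by case: pickP => // t' /andP[? ?] [<-].
case=> est ust; case: pickP => [t' /andP[_]|/(_ t)]; last by rewrite est ust.
move: ust; rewrite !weight_imset => /eqP tE /eqP t'E.
by congr Some; apply/val_inj/val_inj; rewrite /= t'E -tE.
Qed.

(* Main.v *)
Require Import Defs.
From Stdlib Require Import Classical.
From mathcomp Require Import all_boot all_algebra.

(** A pair of distinct states witnesses the failure of Type-2 observability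
    when the two states have the same output and no input word ever makes
    their output trajectories differ.  The automaton started at the vertex
    {x, x'} runs the two trajectories in parallel: reading u replaces a pair by
    its image under [bcn_step u], and the only way to get stuck is that this
    image is not a vertex, i.e. that the two new outputs differ.  Hence a word
    is accepted exactly when it does not separate x from x'
    ([mem_pair_dfa_language]), and both sides of the equivalence say that some
    pair of distinct states with equal outputs is separated by no word.  Once
    the two trajectories have merged, the automaton stays on diagonal vertices
    and never gets stuck, just as the outputs agree from then on. *)

Set Implicit Arguments.
Unset Strict Implicit.
Unset Printing Implicit Defensive.

Section PairDfaLanguage.

Variables (n m q : nat) (B : bcn n m q).

Local Notation state := (Delta (2 ^ n)).
Local Notation input := (Delta (2 ^ m)).

(** The output word of [bcn_HL] on a bare sequence of inputs, so that one can
    do induction on the word. *)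
Definition out_word (x : state) (w : seq input) :=
  map (bcn_out B) (scanl (fun y u => bcn_step B u y) x w).

Lemma is_vertex_pair (x x' : state) :
  is_vertex B [set x; x'] = (bcn_out B x == bcn_out B x').
Proof.
apply/idP/idP => [|eq_out]; last first.
  by apply/existsP; exists x; apply/existsP; exists x'; rewrite eqxx.
(* The representatives of the pair given by [is_vertex] may be x', x. *)
case/existsP=> y /existsP[y' /andP[/eqP eq_xy /eqP eq_out]].
have out_y z : z \in [set x; x'] -> bcn_out B z = bcn_out B y.
  by rewrite eq_xy !inE => /orP[] /eqP->.
by rewrite (out_y x) ?set21 // (out_y x') ?set22.
Qed.

(** A pair moves under u exactly when its image still is a vertex; that image
    is reachable because the pair itself is. *)
Lemma pair_trans_pair (v0 : vertex B) (s : reach_vertex v0) (x x' : state)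
    (u : input) :
  val (val s) = [set x; x'] ->
  if pair_trans s u is Some t
  then bcn_out B (bcn_step B u x) = bcn_out B (bcn_step B u x') /\
       val (val t) = [set bcn_step B u x; bcn_step B u x']
  else bcn_out B (bcn_step B u x) <> bcn_out B (bcn_step B u x').
Proof.
move=> sE.
have imE : bcn_step B u @: val (val s) = [set bcn_step B u x; bcn_step B u x'].
  by rewrite sE imsetU1 imset_set1.
case def_t: (pair_trans s u) => [t|].
  have [_] := (pair_transP s t u).1 def_t.
  rewrite weight_imset imE => /eqP tE; split=> //.
  by apply/eqP; rewrite -is_vertex_pair -tE; apply: valP.
move=> /eqP; rewrite -is_vertex_pair => vP.
pose w : vertex B := exist (fun v => is_vertex B v) _ vP.
have uw : u \in weight (val s) w by rewrite weight_imset imE.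
have sw : edge (val s) w by apply/set0Pn; exists u.
have v0w : connect (@edge _ _ _ B) v0 w.
  exact: connect_trans (valP s) (connect1 sw).
have [_ /(_ (conj sw uw))] := pair_transP s (exist _ w v0w) u.
by rewrite def_t.
Qed.

Lemma pair_dfa_run_pair (v0 : vertex B) (w : seq input)
    (s : dfa_state (pair_dfa v0)) (x x' : state) :
  val (val (s : reach_vertex v0)) = [set x; x'] ->
  isSome (dfa_run s w) = (out_word x w == out_word x' w).
Proof.
elim: w s x x' => [|u w IHw] s x x' sE; first by rewrite eqxx.
have := pair_trans_pair u sE; rewrite /out_word /= eqseq_cons.
case: (pair_trans s u) => [t [-> tE]|/eqP/negPf-> //].
by rewrite eqxx; apply: IHw.
Qed.

(** As all states are final, a word is rejected only by getting stuck. *)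
Lemma mem_pair_dfa_language (v : vertex B) (x x' : state) (w : seq input) :
  val v = [set x; x'] ->
  (w \in dfa_language (pair_dfa v)) = (out_word x w == out_word x' w).
Proof.
move=> vE; rewrite -(@pair_dfa_run_pair v w (dfa_init (pair_dfa v)) _ _ vE).
rewrite unfold_in /dfa_language; case: (dfa_run _ w) => // s.
by rewrite in_setT.
Qed.

Lemma diagonal_pair (v : vertex B) (x x' : state) :
  val v = [set x; x'] -> diagonal v = (x == x').
Proof.
rewrite /diagonal => ->; apply/existsP/eqP => [[y /eqP]|->]; last by exists x'.
rewrite setUid => eq_y.
have /set1P-> : x \in [set y] by rewrite -eq_y set21.
by have /set1P-> : x' \in [set y] by rewrite -eq_y set22.
Qed.

Lemma not_type2_observableP :
  ~ type2_observable B <->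
  exists x x' : state, [/\ x <> x', bcn_out B x = bcn_out B x'
                         & forall w, out_word x w = out_word x' w].
Proof.
split=> [not_obs|[x [x' [ne_x eq_out eq_words]]] obs]; last first.
  by have [p [U [_ /(_ eq_out)[]]]] := obs x x' ne_x; apply/val_inj/eq_words.
have [x /not_all_ex_not[x' nsep]] := not_all_ex_not _ _ not_obs.
have [ne_x {}nsep] := imply_to_and _ _ nsep.
have same p (U : p.-tuple input) : 1 <= p ->
    bcn_out B x = bcn_out B x' /\ bcn_HL B x U = bcn_HL B x' U.
  move=> p_gt0; apply: NNPP => ndiff; apply: nsep; exists p, U; split=> //.
  by move=> eq_out eq_HL; apply: ndiff.
exists x, x'; split=> // [|w].
  (* The equality of initial outputs is only asserted along some word of
     positive length, and there is one as the input alphabet is nonempty. *)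
  have /card_gt0P[u _] := Delta_pow2_gt0 m.
  by have [] := same 1 [tuple u] isT.
case: w => // u w.
by have [_ /(congr1 val)] := same _ (in_tuple (u :: w)) isT.
Qed.

End PairDfaLanguage.

Theorem mainTheorem3 (n m q : nat) (hn : (0 < n)%N) (hm : (0 < m)%N)
    (hq : (0 < q)%N) (B : bcn n m q) :
  ~ type2_observable B <->
  exists v : vertex B,
    ~~ diagonal v /\
    (forall w : seq (Delta (2 ^ m)), w \in dfa_language (pair_dfa v)).
Proof.
rewrite not_type2_observableP.
split=> [[x [x' [/eqP ne_x /eqP eq_out eq_words]]]|[v [ndiag acc]]].
  have vP : is_vertex B [set x; x'] by rewrite is_vertex_pair.
  pose v : vertex B := exist (fun v => is_vertex B v) _ vP.
  have vE : val v = [set x; x'] by [].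
  exists v; rewrite (diagonal_pair vE); split=> // w.
  by rewrite (mem_pair_dfa_language w vE) eq_words.
have /existsP[x /existsP[x' /andP[/eqP vE /eqP eq_out]]] := valP v.
exists x, x'; split=> // [|w].
  by apply/eqP; rewrite -(diagonal_pair vE).
by apply/eqP; rewrite -(mem_pair_dfa_language w vE).
Qed.
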